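(* Let $\Phi$ be a multiplicative distance function with root function $\phi$. Then $\phi(\gamma)\sim|\gamma|$ as $|\gamma|\to\infty$, i.e. $\phi(\gamma)/|\gamma|\to 1$. Conversely, let $\psi:\mathbb{C}\to(0,\infty)$ be a continuous function with $\psi(\gamma)\sim|\gamma|$ as $|\gamma|\to\infty$. Then $\psi$ is the root function of a multiplicative distance function; namely, the function $\Psi:\mathbb{C}[x]\to[0,\infty)$ defined by $\Psi(0)=0$ and $\Psi\big(a\prod_{n=1}^N(x-\gamma_n)\big)=|a|\prod_{n=1}^N\psi(\gamma_n)$ for $a\neq 0$ is a multiplicative distance function.
   Context: Identify the polynomials of degree at most $N$ in $\mathbb{C}[x]$ with $\mathbb{C}^{N+1}$ via coefficient vectors, and give $\mathbb{C}[x]$ the topology generated by the open sets of all these finite-dimensional subspaces. A multiplicative distance function is a function $\Phi:\mathbb{C}[x]\to[0,\infty)$ such that: $\Phi$ is continuous (for this topology); $\Phi(f)=0$ iff $f=0$; $\Phi(wf)=|w|\Phi(f)$ for $w\in\mathbb{C}$; and $\Phi(fg)=\Phi(f)\Phi(g)$ for all $f,g$. Its root function is $\phi:\mathbb{C}\to(0,\infty)$, $\phi(\gamma)=\Phi(x-\gamma)$, so that $\Phi\big(a\prod_{n=1}^N(x-\gamma_n)\big)=|a|\prod_{n=1}^N\phi(\gamma_n)$. *)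

(* Defs.v *)
From HB Require Import structures.
From mathcomp Require Import all_boot all_order all_algebra.
From mathcomp Require Export complex.
From mathcomp Require Import all_classical all_reals all_analysis.

Set Implicit Arguments.
Unset Strict Implicit.
Unset Printing Implicit Defensive.

Import Order.TTheory GRing.Theory Num.Theory.
Import numFieldNormedType.Exports.
Import ComplexField.Normc.

Local Open Scope classical_set_scope.
Local Open Scope ring_scope.
Local Open Scope complex_scope.

(* Throughout, [normc z : R] is the modulus of [z : R[i]] ([`|z|] would live in
   [R[i]]), and [R[i]^o] is [R[i]] with its norm topology. *)

(* The copy of C[x] that carries the direct limit topology of the spaces of
   polynomials of degree at most N, each identified with C^(N+1) through
   [rVpoly]: A is open iff its trace on each of these spaces is open. *)
Definition cpoly (R : realType) : Type := {poly R[i]}.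

Section DirectLimitTopology.
Variable R : realType.

Definition cpoly_open : set_system (cpoly R) :=
  [set A | forall N : nat,
     open [set v : 'rV[R[i]^o]_N.+1 | A (rVpoly v : {poly R[i]})]].

Let cpoly_openT : cpoly_open setT.
Proof. by move=> N; exact: openT. Qed.

Let cpoly_openI : setI_closed cpoly_open.
Proof. by move=> A B oA oB N; exact: openI (oA N) (oB N). Qed.

Let cpoly_open_bigU (I : Type) (f : I -> set (cpoly R)) :
  (forall i, cpoly_open (f i)) -> cpoly_open (\bigcup_i f i).
Proof.
move=> of_ N.
exact: (@bigcup_open 'rV[R[i]^o]_N.+1 I setT
  (fun i => [set v | f i (rVpoly v : {poly R[i]})]) (fun i _ => of_ i N)).
Qed.

HB.instance Definition _ := Choice.copy (cpoly R) {poly R[i]}.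
HB.instance Definition _ := isOpenTopological.Build (cpoly R)
  cpoly_openT cpoly_openI cpoly_open_bigU.

End DirectLimitTopology.

Record multiplicative_distance (R : realType) (Phi : {poly R[i]} -> R) : Prop :=
  MultiplicativeDistance {
    mdist_ge0 : forall f, 0 <= Phi f;
    mdist_continuous : continuous (Phi : cpoly R -> R);
    mdist_eq0 : forall f, Phi f = 0 <-> f = 0;
    mdistZ : forall (w : R[i]) f, Phi (w *: f) = normc w * Phi f;
    mdistM : forall f g, Phi (f * g) = Phi f * Phi g
  }.

Definition root_function (R : realType) (Phi : {poly R[i]} -> R) : R[i] -> R :=
  fun z => Phi ('X - z%:P).

(* The filter of neighbourhoods of infinity, i.e. of "|z| -> oo". *)
Definition complex_infty (R : realType) : set_system (R[i]) :=
  filter_from setT (fun M : R => [set z | M < normc z]).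
Arguments complex_infty : clear implicits.

Global Instance complex_infty_filter (R : realType) :
  ProperFilter (complex_infty R).
Proof.
apply: filter_from_proper.
  apply: filter_from_filter; first by exists 0.
  move=> M1 M2 _ _; exists (Num.max M1 M2) => // z /=.
  by rewrite gt_max => /andP[].
move=> M _; exists ((`|M| + 1)%:C) => /=.
rewrite expr0n addr0 sqrtr_sqr ger0_norm ?addr_ge0//.
by rewrite (le_lt_trans (ler_norm M))// ltrDl.
Qed.

Definition asymptotic_to_modulus (R : realType) (phi : R[i] -> R) : Prop :=
  phi z / normc z @[z --> complex_infty R] --> (1 : R).

(* [s] lists the roots with multiplicity; [s = [::]] gives the nonzero
   constants. *)
Definition root_product_extension (R : realType) (psi : R[i] -> R)
    (Psi : {poly R[i]} -> R) : Prop :=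
  Psi 0 = 0 /\
  forall (a : R[i]) (s : seq R[i]), a != 0 ->
    Psi (a *: \prod_(z <- s) ('X - z%:P)) = normc a * \prod_(z <- s) psi z.

(* Main.v *)
(* For a multiplicative distance, phi(z) / |z| = Phi(z^-1 X - 1), which tends
   to Phi(-1) = 1 as z goes to infinity.

   Conversely, the multiplicativity of Psi reduces its continuity to linear
   factors.  A polynomial of degree at most N is c * l_1 * ... * l_N, each l_i
   being X - z or z X - 1 with |z| <= 1.  Along an ultrafilter on polynomials
   converging coefficientwise, each l_i has a nonzero limit by compactness of
   the unit disc, so c converges too, and it is enough that
   z |-> Psi(z X - 1) = |z| psi(1/z) extends continuously by Psi(-1) = 1 at
   z = 0.  This is the asymptotic hypothesis on psi. *)
Require Import Defs.
From mathcomp Require Import all_boot all_order all_algebra.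
From mathcomp Require Import all_classical all_reals all_analysis.
Import Order.TTheory GRing.Theory Num.Theory.
Import numFieldNormedType.Exports.
Local Open Scope classical_set_scope.
Local Open Scope ring_scope.
Local Open Scope complex_scope.

Set Implicit Arguments.
Unset Strict Implicit.
Unset Printing Implicit Defensive.
Import ComplexField.Normc.

(** * The real-valued modulus and limits in the complex plane *)

Section ComplexModulus.
Variable R : realType.
Implicit Types (z w : R[i]).

Lemma normc_normE z : `|z| = (normc z)%:C.
Proof. by []. Qed.

Lemma normc_ge0 z : 0 <= normc z.
Proof. by rewrite -lecR -normc_normE; exact: normr_ge0. Qed.

Lemma normc_eq0 z : (normc z == 0) = (z == 0).
Proof. by apply/eqP/eqP => [/eq0_normc //|->]; rewrite normc0. Qed.

Lemma normc_gt0 z : (0 < normc z) = (z != 0).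
Proof. by rewrite lt_def normc_ge0 andbT normc_eq0. Qed.

Lemma normc_opp z : normc (- z) = normc z.
Proof. by apply: complexI; rewrite -!normc_normE normrN. Qed.

Lemma normc_dist z w : `|normc z - normc w| <= normc (z - w).
Proof.
have le_norm (x y : R[i]) : normc x - normc y <= normc (x - y).
  rewrite -lecR rmorphB; change (`|x| - `|y| <= `|x - y|); exact: lerB_dist.
by rewrite ler_norml le_norm andbT lerNl opprB -(normc_opp (z - w)) opprB le_norm.
Qed.

Lemma normc_le_ReIm z : normc z <= `|complex.Re z| + `|complex.Im z|.
Proof.
case: z => a b /=; rewrite -[leRHS]ger0_norm ?addr_ge0// -sqrtr_sqr.
rewrite ler_wsqrtr// sqrrD !real_normK ?num_real//.
by rewrite addrAC lerDl mulrn_wge0// mulr_ge0.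
Qed.

Lemma ler_normc_Re z : `|complex.Re z| <= normc z.
Proof. by rewrite -lecR -normc_normE; exact: normc_ge_Re. Qed.

Lemma ler_normc_Im z : `|complex.Im z| <= normc z.
Proof.
by case: z => a b /=; rewrite -sqrtr_sqr ler_wsqrtr// lerDr sqr_ge0.
Qed.

(** The norm on [R[i]^o] takes values in [R[i]], so its radii are positive elements of [R[i]]. Such
    elements are real, hence real radii suffice. *)
Lemma cvgc_distP (T : Type) (F : set_system T) (FF : Filter F)
    (f : T -> R[i]^o) (l : R[i]^o) :
  f @ F --> l <-> forall e : R, 0 < e -> \forall t \near F, normc (l - f t) < e.
Proof.
split=> [/cvgrPdist_lt fl e e0|fl].
  by have := fl e%:C; rewrite ltcR => /(_ e0); apply: filterS => t; rewrite normc_normE ltcR.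
apply/cvgrPdist_lt => e e0.
have eE : e = (complex.Re e)%:C by rewrite RRe_real ?gtr0_real.
move: e0; rewrite eE ltcR => e0.
by apply: filterS (fl _ e0) => t; rewrite normc_normE ltcR.
Qed.

Lemma near_normc (u : R[i]^o) (e : R) :
  0 < e -> \forall z \near u, normc (u - z) < e.
Proof. by move=> e0; apply: (cvgc_distP (nbhs_filter u) id u).1. Qed.

Lemma cvg_normc (T : Type) (F : set_system T) (FF : Filter F)
    (f : T -> R[i]^o) (l : R[i]^o) :
  f @ F --> l -> normc (f t) @[t --> F] --> normc l.
Proof.
move=> /cvgc_distP fl; apply/cvgrPdist_lt => e /fl.
by apply: filterS => t; apply: le_lt_trans; exact: normc_dist.
Qed.

End ComplexModulus.

(** * Convergence tested on ultrafilters, and compactness of bounded sets *)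

Section UltraFilters.

Lemma ultra_fmap (T U : Type) (f : T -> U) (F : set_system T) :
  UltraFilter F -> UltraFilter (f @ F).
Proof.
move=> FU; split=> [|G GF FG]; first exact: fmap_proper_filter.
rewrite eqEsubset; split=> // A GA.
have [//|FnA] := in_ultra_setVsetC (f @^-1` A) FU.
have /filter_ex[x []] // : G (A `&` ~` A) by apply: filterI => //; exact: FG.
Qed.

(** If the preimage of some neighbourhood [A] of [l] is not in [F], then [F] restricted to the
    complement of this preimage is proper. An ultrafilter refining it would contain both the
    preimage and its complement. *)
Lemma cvg_ultra (T : Type) (U : topologicalType) (f : T -> U)
    (F : set_system T) (FF : Filter F) (l : U) :
  (forall G : set_system T, UltraFilter G -> F `<=` G -> f @ G --> l) ->
  f @ F --> l.
Proof.
move=> fl A nA; apply: contrapT => nFA.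
have FP : ProperFilter (within (~` (f @^-1` A)) F).
  apply: Build_ProperFilter; rewrite /within /= => F0.
  by apply: nFA; apply: filterS F0 => x; apply: contrapT.
have [G [GU FG]] := ultraFilterLemma FP.
have GA : G (f @^-1` A).
  by apply: fl nA => // B FB; apply: FG; apply: filterS FB => x Bx.
have GnA : G (~` (f @^-1` A)) by apply: FG; exact: withinT.
have /filter_ex[x []] // : G (f @^-1` A `&` ~` (f @^-1` A)) by exact: filterI.
Qed.

Lemma ultra_cvg_bounded (R : realType) (T : Type) (F : set_system T)
    (f : T -> R) (M : R) :
  UltraFilter F -> (forall t, `|f t| <= M) -> exists l : R, f @ F --> l.
Proof.
move=> FU fM; have := @segment_compact R (- M) M; rewrite compact_ultra.
case/(_ (f @ F) (ultra_fmap f FU)) => [|l [_ fl]]; last by exists l.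
by apply: (@filterE _ F) => t; rewrite /= in_itv/= -ler_norml; exact: fM.
Qed.

Lemma ultra_cvgc_bounded (R : realType) (T : Type) (F : set_system T)
    (f : T -> R[i]^o) (M : R) :
  UltraFilter F -> (forall t, normc (f t) <= M) ->
  exists l : R[i]^o, f @ F --> l.
Proof.
move=> FU fM.
have [t|a fa] := @ultra_cvg_bounded R T F (fun t => complex.Re (f t)) M FU.
  exact: le_trans (ler_normc_Re _) (fM t).
have [t|b fb] := @ultra_cvg_bounded R T F (fun t => complex.Im (f t)) M FU.
  exact: le_trans (ler_normc_Im _) (fM t).
exists (a +i* b); apply/cvgc_distP => e e0.
have e20 : 0 < e / 2 by rewrite divr_gt0.
move/cvgrPdist_lt : fa => /(_ _ e20) fa; move/cvgrPdist_lt : fb => /(_ _ e20) fb.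
apply: filterS2 fa fb => t xa yb.
apply: le_lt_trans (normc_le_ReIm _) _.
by case: (f t) xa yb => x y /= xa yb; rewrite [e]splitr ltrD.
Qed.

End UltraFilters.

(** * Coefficientwise convergence and the direct limit topology *)

Definition coef_cvg (R : realType) (T : Type) (F : set_system T)
    (h : T -> {poly R[i]}) (h0 : {poly R[i]}) : Prop :=
  forall i, ((h t)`_i : R[i]^o) @[t --> F] --> (h0`_i : R[i]^o).

Section CoefficientwiseConvergence.
Variable R : realType.
Implicit Types (T : Type) (p : {poly R[i]}).

Lemma coef_cvgM T (F : set_system T) (FF : Filter F) (g h : T -> {poly R[i]}) g0 h0 :
  coef_cvg F g g0 -> coef_cvg F h h0 ->
  coef_cvg F (fun t => g t * h t) (g0 * h0).
Proof.
move=> gg0 hh0 i; rewrite coefM.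
under eq_cvg do rewrite coefM.
by apply: cvg_big => [|j _]; [exact: add_continuous|exact: cvgM].
Qed.

Lemma coef_cvg_unique T (F : set_system T) (FF : ProperFilter F) (h : T -> {poly R[i]}) h0 h1 :
  coef_cvg F h h0 -> coef_cvg F h h1 -> h0 = h1.
Proof.
move=> hh0 hh1; apply/polyP => i.
exact: (cvg_unique (@norm_hausdorff _ R[i]^o) (hh0 i) (hh1 i)).
Qed.

Lemma near_coef_cvg T (F : set_system T) (FF : Filter F)
    (g h : T -> {poly R[i]}) h0 :
  (\forall t \near F, g t = h t) -> coef_cvg F h h0 -> coef_cvg F g h0.
Proof.
move=> gh hh0 i; have hi := hh0 i.
apply: cvg_trans hi; apply: near_eq_cvg.
by apply: filterS gh => t ->.
Qed.

Lemma size_coef_cvg T (F : set_system T) (FF : ProperFilter F) (h : T -> {poly R[i]}) h0 n :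
  (forall t, (size (h t) <= n)%N) -> coef_cvg F h h0 -> (size h0 <= n)%N.
Proof.
move=> sh hh0; apply/leq_sizeP => i ni.
apply: (cvg_unique (@norm_hausdorff _ R[i]^o) (hh0 i)).
have -> : (fun t => (h t)`_i : R[i]^o) = cst 0.
  by apply/funext => t; apply/leq_sizeP : ni; exact: sh.
exact: cvg_cst.
Qed.

Lemma coef_cvg_poly_rV T (F : set_system T) (FF : Filter F) (h : T -> {poly R[i]}) h0 n :
  coef_cvg F h h0 ->
  (poly_rV (h t) : 'rV[R[i]^o]_n) @[t --> F] --> (poly_rV h0 : 'rV[R[i]^o]_n).
Proof.
move=> hh0 A [P nP PA].
suff : \forall t \near F, forall j, P ord0 j (h t)`_j.
  by apply: filterS => t Pt; apply: PA => i j; rewrite ord1 mxE; exact: Pt.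
apply: filter_forall => j; rewrite /prop_near1.
by have := nP ord0 j; rewrite mxE => /hh0.
Qed.

(** The degree bound makes [Phi \o h] factor through C^(n+1), where coefficientwise convergence is
    convergence of vectors. *)
Lemma cpoly_continuous_cvg (Phi : {poly R[i]} -> R) T (F : set_system T)
    (FF : ProperFilter F) (h : T -> {poly R[i]}) h0 n :
  continuous (Phi : cpoly R -> R) ->
  (forall t, (size (h t) <= n.+1)%N) -> coef_cvg F h h0 ->
  Phi (h t) @[t --> F] --> Phi h0.
Proof.
move=> cPhi sh hh0.
have cPhin : continuous (fun v : 'rV[R[i]^o]_n.+1 => Phi (rVpoly v)).
  by apply/continuousP => A oA; have /continuousP/(_ A oA)/(_ n) := cPhi.
have sh0 := size_coef_cvg FF sh hh0.
have -> : (fun t => Phi (h t)) =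
    (fun v : 'rV[R[i]^o]_n.+1 => Phi (rVpoly v)) \o (fun t => poly_rV (h t)).
  by apply/funext => t /=; rewrite poly_rV_K.
have := cvg_comp _ _ (coef_cvg_poly_rV (n:=n.+1) _ hh0) (cPhin (poly_rV h0)).
rewrite poly_rV_K; [exact|exact: sh0].
Qed.

(** Openness in [cpoly R] is tested on each C^(n+1), and continuity there on ultrafilters finer than
    a neighbourhood filter. Along these the polynomials converge coefficientwise, since coordinates
    are continuous. *)
Lemma cvg_cpoly_continuous (Phi : {poly R[i]} -> R) :
  (forall T (F : set_system T) (FF : UltraFilter F) (h : T -> {poly R[i]}) h0 n,
    (forall t, (size (h t) <= n.+1)%N) -> coef_cvg F h h0 ->
    Phi (h t) @[t --> F] --> Phi h0) ->
  continuous (Phi : cpoly R -> R).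
Proof.
move=> cPhi.
suff cPhin n : continuous (fun v : 'rV[R[i]^o]_n.+1 => Phi (rVpoly v)).
  apply/continuousP => A oA.
  by change (cpoly_open (Phi @^-1` A)) => n; have /continuousP/(_ A oA) := cPhin n.
move=> v0; apply: (@cvg_ultra _ _ _ (nbhs v0) (nbhs_filter v0)) => G GU vG.
apply: cPhi => [v|i]; first exact: size_poly.
rewrite coef_rVpoly; under eq_cvg do rewrite coef_rVpoly.
(* Coefficients of index beyond [n] are constantly 0; the others are coordinates of the vector. *)
case: insubP => [j _ _|_]; last exact: cvg_cst.
apply: cvg_trans (@coord_continuous _ _ _ ord0 j v0).
exact: cvg_app.
Qed.

End CoefficientwiseConvergence.

(** * Linear factors with parameter in the unit disc *)

Section LinearFactors.
Variable R : realType.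
Implicit Types (T : Type) (z : R[i]) (p : {poly R[i]}).

Lemma coef_cvg_XsubC T (F : set_system T) (FF : Filter F)
    (z : T -> R[i]^o) (z0 : R[i]^o) :
  z @ F --> z0 -> coef_cvg F (fun t => 'X - (z t)%:P) ('X - z0%:P).
Proof.
move=> zz0 i; rewrite coefB coefC; under eq_cvg do rewrite coefB coefC.
apply: cvgB; first exact: cvg_cst.
by case: eqP => _; [exact: zz0|exact: cvg_cst].
Qed.

Lemma coef_cvg_ZXsub1 T (F : set_system T) (FF : Filter F)
    (z : T -> R[i]^o) (z0 : R[i]^o) :
  z @ F --> z0 -> coef_cvg F (fun t => z t *: 'X - 1) (z0 *: 'X - 1).
Proof.
move=> zz0 i; rewrite coefB coefZ; under eq_cvg do rewrite coefB coefZ.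
apply: cvgB; last exact: cvg_cst.
by apply: cvgM => //; exact: cvg_cst.
Qed.

Lemma size_ZXsub1 z : (size (z *: 'X - 1)%R <= 2)%N.
Proof.
rewrite (leq_trans (size_polyD _ _))// geq_max size_polyN size_poly1.
by rewrite (leq_trans (size_scale_leq _ _))// size_polyX.
Qed.

Lemma ZXsub1_neq0 z : z *: 'X - 1 != 0 :> {poly R[i]}.
Proof.
apply/eqP => /(congr1 (fun p => p`_0)) /eqP.
by rewrite coefB coefZ coefX mulr0 coef1 coef0 sub0r oppr_eq0 oner_eq0.
Qed.

Lemma ZXsub1E z : z != 0 -> z *: 'X - 1 = z *: ('X - (z^-1)%:P) :> {poly R[i]}.
Proof. by move=> z0; rewrite scalerBr -[z *: _%:P]mul_polyC -polyCM divff. Qed.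

Lemma cvg_complex_inftyV :
  (z^-1 : R[i]^o) @[z --> complex_infty R] --> (0 : R[i]^o).
Proof.
apply/cvgc_distP => e e0; exists e^-1 => // z /= ez.
rewrite sub0r normc_opp normcV -[e]invrK ltf_pV2 // posrE ?invr_gt0//.
by apply: lt_trans ez; rewrite invr_gt0.
Qed.

(* A polynomial of degree d <= N has N - d roots "at infinity", represented by
   z = 0 in the second form. *)
Definition unit_linear p :=
  exists2 z, normc z <= 1 & p = 'X - z%:P \/ p = z *: 'X - 1.

(** When the degree is maximal, a root [z] is split off. If it lies outside the unit disc,
    ['X - z%:P] is rescaled to [z^-1 *: 'X - 1] and the scalar [z] moves to the cofactor. *)
Lemma split_unit_linear n p : (size p <= n.+2)%N ->
  exists ql : {poly R[i]} * {poly R[i]},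
    [/\ (size ql.1 <= n.+1)%N, unit_linear ql.2 & p = ql.1 * ql.2].
Proof.
move=> sp; have [sp1|sp1] := leqP (size p) n.+1.
  (* The factor at infinity is the constant -1, whence the sign of the cofactor. *)
  exists (- p, 0 *: 'X - 1); split => /=.
  - by rewrite size_polyN.
  - by exists 0; [rewrite normc0|right].
  - by rewrite scale0r sub0r mulrNN mulr1.
have /closed_rootP[z /factor_theorem[q pE]] : size p != 1.
  by rewrite gtn_eqF// (leq_trans _ sp1).
have sq : (size q <= n.+1)%N.
  have [->|q0] := eqVneq q 0; first by rewrite size_poly0.
  by move: sp; rewrite pE size_Mmonic ?monicXsubC// size_XsubC addn2.
have [z1|z1] := leP (normc z) 1.
  by exists (q, 'X - z%:P); split => //=; exists z => //; left.
have z0 : z != 0 by rewrite -normc_gt0 (lt_trans _ z1).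
exists (z *: q, z^-1 *: 'X - 1); split => /=.
- exact: leq_trans (size_scale_leq _ _) sq.
- exists z^-1; last by right.
  by rewrite normcV invf_le1 ?(lt_trans _ z1)// ltW.
- by rewrite ZXsub1E ?invr_eq0// invrK -scalerAl -scalerAr scalerA divff// scale1r.
Qed.

End LinearFactors.

(** * Asymptotics of the root function *)

Section RootFunctionAsymptotics.
Variables (R : realType) (Phi : {poly R[i]} -> R).
Hypothesis PhiP : multiplicative_distance Phi.

Lemma mdist1 : Phi 1 = 1.
Proof.
have : Phi 1 * Phi 1 = Phi 1 * 1 by rewrite -(mdistM PhiP) !mulr1.
by apply: mulfI; apply/eqP => /(mdist_eq0 PhiP)/eqP; rewrite oner_eq0.
Qed.

Lemma root_function_asymptotic : asymptotic_to_modulus (root_function Phi).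
Proof.
have Phi0 : Phi (0 *: 'X - 1) = 1.
  rewrite scale0r sub0r -scaleN1r (mdistZ PhiP) mdist1 mulr1.
  by rewrite normc_opp normc1.
rewrite /asymptotic_to_modulus -Phi0.
have cvgPhi :
    Phi (z^-1 *: 'X - 1) @[z --> complex_infty R] --> Phi (0 *: 'X - 1).
  apply: (cpoly_continuous_cvg _ (n := 1) (mdist_continuous PhiP)) => [z|].
    exact: size_ZXsub1.
  exact: coef_cvg_ZXsub1 (@cvg_complex_inftyV R).
(* The bound 0 on the modulus already excludes [z = 0], and homogeneity then identifies the two
   functions. *)
apply: cvg_trans cvgPhi; apply: near_eq_cvg; exists 0 => // z gt0.
have z0 : z != 0 by rewrite -normc_gt0; exact: gt0.
rewrite /root_function.
by rewrite ZXsub1E ?invr_eq0// invrK (mdistZ PhiP) normcV mulrC.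
Qed.

End RootFunctionAsymptotics.

(** * The multiplicative extension of a prescribed root function *)

Section RootProductExtension.
Variables (R : realType) (psi : R[i] -> R).

(** A product of monic linear factors determines its roots up to permutation, so the product of
    [psi] over a chosen list of roots is independent of the choice. At the zero polynomial the
    leading coefficient supplies the value 0. *)
Lemma root_product_extension_exists_unique :
  exists! Psi : {poly R[i]} -> R, root_product_extension psi Psi.
Proof.
pose rts (p : {poly R[i]}) := sval (closed_field_poly_normal p).
have rtsP p : p = lead_coef p *: \prod_(z <- rts p) ('X - z%:P).
  exact: svalP (closed_field_poly_normal p).
exists (fun p => normc (lead_coef p) * \prod_(z <- rts p) psi z).
split=> [|Psi [Psi0 PsiE]].
  split=> [|a s a0]; first by rewrite lead_coef0 normc0 mul0r.
  set p := _ *: _.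
  have lp : lead_coef p = a by rewrite lead_coefZ lead_coef_prod_XsubC mulr1.
  rewrite lp; congr (_ * _); apply: perm_big; apply: prod_XsubC_eq.
  by apply: (scalerI a0); rewrite -[in LHS]lp -rtsP.
apply/funext => p.
have [->|p0] := eqVneq p 0; first by rewrite Psi0 lead_coef0 normc0 mul0r.
by rewrite [in RHS](rtsP p) PsiE ?lead_coef_eq0.
Qed.

Variable Psi : {poly R[i]} -> R.
Hypothesis PsiP : root_product_extension psi Psi.

Lemma rpe_prod a s :
  Psi (a *: \prod_(z <- s) ('X - z%:P)) = normc a * \prod_(z <- s) psi z.
Proof.
case: PsiP => Psi0 PsiE; have [->|a0] := eqVneq a 0; last exact: PsiE.
by rewrite scale0r normc0 mul0r.
Qed.

Lemma rpeZ w p : Psi (w *: p) = normc w * Psi p.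
Proof.
have [s ->] := closed_field_poly_normal p.
by rewrite scalerA !rpe_prod normcM mulrA.
Qed.

Lemma rpeM p q : Psi (p * q) = Psi p * Psi q.
Proof.
have [s ->] := closed_field_poly_normal p.
have [t ->] := closed_field_poly_normal q.
rewrite -scalerAl -scalerAr scalerA -big_cat !rpe_prod big_cat /= normcM.
by rewrite mulrACA.
Qed.

Lemma rpe_XsubC z : Psi ('X - z%:P) = psi z.
Proof.
by have := rpe_prod 1 [:: z]; rewrite !big_seq1 scale1r normc1 mul1r.
Qed.

Lemma rpe1 : Psi 1 = 1.
Proof. by have := rpe_prod 1 [::]; rewrite !big_nil scale1r normc1 mulr1. Qed.

Lemma rpe_ZXsub1_0 : Psi (0 *: 'X - 1) = 1.
Proof.
by rewrite scale0r sub0r -scaleN1r rpeZ rpe1 mulr1 normc_opp normc1.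
Qed.

Hypothesis psi_gt0 : forall z, 0 < psi z.

Lemma rpe_ge0 p : 0 <= Psi p.
Proof.
have [s ->] := closed_field_poly_normal p.
by rewrite rpe_prod mulr_ge0 ?normc_ge0// prodr_ge0// => z _; exact: ltW.
Qed.

Lemma rpe_eq0 p : Psi p = 0 <-> p = 0.
Proof.
split=> [|->]; last by case: PsiP.
have [s pE] := closed_field_poly_normal p.
rewrite pE rpe_prod => /eqP; rewrite mulf_eq0 normc_eq0 lead_coef_eq0.
case/orP => [/eqP ->|]; first by rewrite lead_coef0 scale0r.
by rewrite gt_eqF// prodr_gt0.
Qed.

Hypothesis psi_cont : continuous (psi : R[i]^o -> R).
Hypothesis psi_asymp : asymptotic_to_modulus psi.

Lemma rpe_cvg_ZXsub1 (u : R[i]^o) :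
  Psi (z *: 'X - 1) @[z --> (u : R[i]^o)] --> Psi (u *: 'X - 1).
Proof.
have PsiE (z : R[i]) : z != 0 -> Psi (z *: 'X - 1) = normc z * psi z^-1.
  by move=> z0; rewrite ZXsub1E// rpeZ rpe_XsubC.
have [->|u0] := eqVneq u 0.
  rewrite rpe_ZXsub1_0; have FF0 := nbhs_filter (0 : R[i]^o).
  apply/cvgrPdist_lt => e e0.
  move/cvgrPdist_lt : psi_asymp => /(_ e e0) [M _ Me].
  (* [M] may be negative, whereas [|M| + 1] is positive and exceeds [M]; a nonzero [z] of modulus
     below its inverse has [z^-1] beyond [M]. *)
  have K0 : 0 < `|M| + 1 by rewrite ltr_wpDl.
  have := @near_normc R 0 (`|M| + 1)^-1.
  rewrite invr_gt0 => /(_ K0); apply: filterS => z.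
  rewrite sub0r normc_opp => zK.
  have [->|z0] := eqVneq z 0; first by rewrite rpe_ZXsub1_0 subrr normr0.
  have := Me z^-1; rewrite /= normcV invrK PsiE// mulrC; apply.
  apply: (@lt_trans _ _ (`|M| + 1)); first by rewrite ltr_pwDr// ler_norm.
  by rewrite -[ltLHS]invrK ltf_pV2// posrE ?normc_gt0 ?invr_gt0.
rewrite PsiE//.
have u_near : \forall z \near (u : R[i]^o), z != 0.
  have := @near_normc R u (normc u).
  rewrite normc_gt0 => /(_ u0); apply: filterS => z.
  by apply: contraTneq => ->; rewrite subr0 ltxx.
have FFu := nbhs_filter u; have uu := @cvg_id _ (nbhs u).
have cvgpsi : normc z * psi z^-1 @[z --> (u : R[i]^o)] --> normc u * psi u^-1.
  apply: cvgM; first exact: cvg_normc uu.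
  by apply: (cvg_comp _ _ (cvgV u0 uu)); exact: psi_cont.
apply: cvg_trans cvgpsi; apply: near_eq_cvg.
by apply: filterS u_near => z z0; rewrite PsiE.
Qed.

(** * Continuity of the extension along an ultrafilter *)

Section AlongUltrafilter.
Variables (T : Type) (F : set_system T).
Hypothesis FU : UltraFilter F.

Lemma rpe_cvg_unit_linear (l : T -> {poly R[i]}) :
  (forall t, unit_linear (l t)) ->
  exists l0, [/\ l0 != 0, coef_cvg F l l0 & Psi (l t) @[t --> F] --> Psi l0].
Proof.
move=> lP.
have /choice[z zP] t : exists z : R[i]^o,
    normc z <= 1 /\ (l t = 'X - z%:P \/ l t = z *: 'X - 1).
  by have [z z1 lz] := lP t; exists z.
have [z0 zz0] := ultra_cvgc_bounded FU (fun t => (zP t).1).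
(* The ultrafilter selects one of the two forms of the factor, which then holds eventually. *)
have [lX|lX] := in_ultra_setVsetC [set t | l t = 'X - (z t)%:P] FU.
  exists ('X - z0%:P); split; first by rewrite polyXsubC_eq0.
    by apply: near_coef_cvg lX _; exact: coef_cvg_XsubC.
  rewrite rpe_XsubC.
  have psiz := cvg_comp _ _ zz0 (@psi_cont z0); apply: cvg_trans psiz.
  by apply: near_eq_cvg; apply: filterS lX => t /= ->; rewrite rpe_XsubC.
have {}lX : \forall t \near F, l t = z t *: 'X - 1.
  by apply: filterS lX => t nlX; case: (zP t) => _ [/nlX|->].
exists (z0 *: 'X - 1); split; first exact: ZXsub1_neq0.
  by apply: near_coef_cvg lX _; exact: coef_cvg_ZXsub1.
have Psiz := cvg_comp _ _ zz0 (@rpe_cvg_ZXsub1 z0); apply: cvg_trans Psiz.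
by apply: near_eq_cvg; apply: filterS lX => t /= ->.
Qed.

(** No convergence of [h] is assumed: peeling off [n] unit linear factors leaves a constant [c t],
    and compactness makes the product of these factors converge to a nonzero limit. Only [c] can
    fail to converge. *)
Lemma rpe_normal_form n (h : T -> {poly R[i]}) :
  (forall t, (size (h t) <= n.+1)%N) ->
  exists (c : T -> R[i]) (p : T -> {poly R[i]}) p0,
    [/\ forall t, h t = c t *: p t, p0 != 0, coef_cvg F p p0 &
        Psi (p t) @[t --> F] --> Psi p0].
Proof.
elim: n h => [|n IHn] h sh.
  exists (fun t => (h t)`_0), (cst 1), 1; split.
  - by move=> t; rewrite alg_polyC; exact: size1_polyC.
  - exact: oner_neq0.
  - by move=> i; exact: cvg_cst.
  - exact: cvg_cst.
have /choice[ql qlP] t := split_unit_linear (sh t).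
have [|c [p [p0 [qE p0_neq0 pp0 Psip]]]] := IHn (fun t => (ql t).1).
  by move=> t; case: (qlP t).
have [|l0 [l0_neq0 ll0 Psil]] := @rpe_cvg_unit_linear (fun t => (ql t).2).
  by move=> t; case: (qlP t).
exists c, (fun t => p t * (ql t).2), (p0 * l0); split.
- by move=> t; case: (qlP t) => _ _ ->; rewrite qE scalerAl.
- by rewrite mulf_neq0.
- exact: coef_cvgM.
- by rewrite rpeM; under eq_cvg do rewrite rpeM; exact: cvgM.
Qed.

Lemma rpe_cvg n (h : T -> {poly R[i]}) h0 :
  (forall t, (size (h t) <= n.+1)%N) -> coef_cvg F h h0 ->
  Psi (h t) @[t --> F] --> Psi h0.
Proof.
move=> sh hh0.
have [c [p [p0 [hE p0_neq0 pp0 Psip]]]] := rpe_normal_form sh.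
(* At the leading index of [p0] the limit coefficient is nonzero, so [c] is eventually a quotient of
   convergent coefficients. *)
pose i := (size p0).-1.
have p0i : p0`_i != 0 by rewrite -lead_coefE lead_coef_eq0.
have cc0 : (c t : R[i]^o) @[t --> F] --> (h0`_i / p0`_i : R[i]^o).
  have hp : ((h t)`_i / (p t)`_i : R[i]^o) @[t --> F] --> (h0`_i / p0`_i : R[i]^o).
    by apply: cvgM; [exact: hh0|exact: cvgV].
  apply: cvg_trans hp; apply: near_eq_cvg.
  have /cvgc_distP/(_ (normc p0`_i)) := pp0 i.
  rewrite normc_gt0 => /(_ p0i); apply: filterS => t pt.
  rewrite hE coefZ mulfK//.
  by apply: contraTneq pt => ->; rewrite subr0 ltxx.
(* Both sides are coefficientwise limits of [h], so homogeneity reduces the claim to the limits of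
   [c] and [Psi (p t)]. *)
have -> : h0 = (h0`_i / p0`_i) *: p0.
  apply: (coef_cvg_unique _ hh0) => j; rewrite coefZ.
  under eq_cvg do rewrite hE coefZ.
  exact: cvgM cc0 (pp0 j).
rewrite rpeZ; under eq_cvg do rewrite hE rpeZ.
by apply: cvgM => //; exact: cvg_normc.
Qed.

End AlongUltrafilter.

Lemma rpe_multiplicative_distance : multiplicative_distance Psi.
Proof.
split; [exact: rpe_ge0| |exact: rpe_eq0|exact: rpeZ|exact: rpeM].
by apply: cvg_cpoly_continuous => T F FU h h0 n; exact: rpe_cvg.
Qed.

End RootProductExtension.

Theorem theorem1 (R : realType) :
  (forall Phi : {poly R[i]} -> R,
     multiplicative_distance Phi ->
     asymptotic_to_modulus (root_function Phi)) /\
  (forall psi : R[i] -> R,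
     (forall z, 0 < psi z) ->
     continuous (psi : R[i]^o -> R) ->
     asymptotic_to_modulus psi ->
     (exists! Psi : {poly R[i]} -> R, root_product_extension psi Psi) /\
     (forall Psi : {poly R[i]} -> R,
        root_product_extension psi Psi ->
        multiplicative_distance Psi /\ root_function Psi = psi)).
Proof.
split=> [|psi psi0 cpsi apsi]; first exact: root_function_asymptotic.
split; first exact: root_product_extension_exists_unique.
move=> Psi PsiP; split; first exact: rpe_multiplicative_distance PsiP _ _ _.
by apply/funext => z; exact: rpe_XsubC.
Qed.
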